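(* Let $n$ be a natural number, let $q$ be a prime not dividing $n$, let $r$ be a power of a prime number $l$ not dividing $n$, and let $\chi:(\mathbb{Z}/q\mathbb{Z})^*\to\mu_r$ be a character. Let $\zeta_q,\zeta_r$ be primitive $q$-th and $r$-th roots of unity, $\tau(\chi)=-\sum_{x\in(\mathbb{Z}/q\mathbb{Z})^*}\zeta_q^x\chi(x)$ the Gaussian sum, and $\sigma_n$ the automorphism of $\mathbb{Q}(\zeta_q,\zeta_r)$ with $\sigma_n(\zeta_r)=\zeta_r^n$, $\sigma_n(\zeta_q)=\zeta_q$. Suppose that (1) for every prime $p$ dividing $n$ there exists $\lambda_p$ in the ring $\mathbb{Z}_l$ of $l$-adic integers with $p^{l-1}=n^{(l-1)\lambda_p}$ in $\mathbb{Z}_l^*$; (2) $\tau(\chi)^{\sigma_n-n}\in\langle\zeta_r\rangle$ in the ring $\mathbb{Z}[\zeta_q,\zeta_r]/(n)$, where $\langle\zeta_r\rangle$ denotes the cyclic subgroup of $(\mathbb{Z}[\zeta_q,\zeta_r]/(n))^*$ generated by the image of $\zeta_r$. Then $\chi(p)=\chi(n)^{\lambda_p}$ for every prime divisor $p$ of $n$.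
   Context: $\mu_r$ is the group of $r$-th roots of unity in $\overline{\mathbb{Q}}^*$. Exponential notation: $\tau^{\sigma_n-n}=\sigma_n(\tau)\tau^{-n}$ (here $\tau(\chi)$ is a unit modulo $n$). Since $n^{l-1}$ and $p^{l-1}$ are $\equiv1\pmod l$, the power $n^{(l-1)\lambda_p}$ is defined in $\mathbb{Z}_l^*$; and for an $l$-power root of unity $\zeta$ and $\lambda\in\mathbb{Z}_l$, $\zeta^\lambda$ is defined via reduction of $\lambda$ modulo the order of $\zeta$. *)

(* Defs.v *)
From HB Require Import structures.
From mathcomp Require Import all_boot all_order all_algebra all_fingroup all_field.
From mathcomp Require Import boolp.

Set Implicit Arguments.
Unset Strict Implicit.
Unset Printing Implicit Defensive.

Import GRing.Theory.
Local Open Scope ring_scope.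

(* The ring of l-adic integers is the inverse limit of the rings Z/l^(k+1)Z.
   Level k is the residue modulo l^(k+1), so that every modulus is at least 2
   and 'Z_(l ^ k.+1) is the intended ring (for 1 < l). The values of ladic at
   l = 0 and l = 1 are irrelevant. *)
Record ladic (l : nat) := Ladic {
  ladic_res :> forall k, 'Z_(l ^ k.+1);
  ladic_coh : forall k,
    (nat_of_ord (ladic_res k.+1))%:R = ladic_res k :> 'Z_(l ^ k.+1)
}.
Arguments Ladic {l} ladic_res ladic_coh.

HB.instance Definition _ l := gen_eqMixin (ladic l).
HB.instance Definition _ l := gen_choiceMixin (ladic l).

Lemma ladicP l (x y : ladic l) : (forall k, x k = y k) -> x = y.
Proof.
case: x y => [x cx] [y cy] /= xy; have exy : x = y by apply: functional_extensionality_dep.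
by rewrite exy in cx *; congr Ladic; apply: Prop_irrelevance.
Qed.

Lemma natr_Zp_eqP m (a b : nat) :
  reflect (a = b %[mod (Zp_trunc m).+2]) ((a%:R : 'Z_m) == b%:R).
Proof.
by rewrite !Zp_nat; apply: (iffP eqP) => [/(congr1 val)|ab] //=; apply: val_inj.
Qed.

Lemma dvd_Zp_trunc l k :
  ((Zp_trunc (l ^ k.+1)).+2 %| (Zp_trunc (l ^ k.+2)).+2)%N.
Proof.
case: l => [|[|l]]; first by rewrite !exp0n.
  by rewrite !exp1n.
by rewrite !Zp_cast ?dvdn_exp2l // -[1%N](expn0 l.+2) ltn_exp2l.
Qed.

Lemma ladic_red_nat l k (a : nat) :
  (nat_of_ord (a%:R : 'Z_(l ^ k.+2)))%:R = a%:R :> 'Z_(l ^ k.+1).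
Proof.
apply/eqP/natr_Zp_eqP; rewrite Zp_nat /=.
by rewrite modn_dvdm // dvd_Zp_trunc.
Qed.

Section LadicRing.
Variable l : nat.
Implicit Types x y z : ladic l.

Fact ladic0_coh k : (nat_of_ord (0 : 'Z_(l ^ k.+2)))%:R = 0 :> 'Z_(l ^ k.+1).
Proof. exact: (ladic_red_nat l k 0). Qed.
Definition ladic0 := Ladic (fun k => 0 : 'Z_(l ^ k.+1)) ladic0_coh.

Fact ladic1_coh k : (nat_of_ord (1 : 'Z_(l ^ k.+2)))%:R = 1 :> 'Z_(l ^ k.+1).
Proof. exact: (ladic_red_nat l k 1). Qed.
Definition ladic1 := Ladic (fun k => 1 : 'Z_(l ^ k.+1)) ladic1_coh.

Fact ladic_add_coh x y k :
  (nat_of_ord (x k.+1 + y k.+1))%:R = x k + y k :> 'Z_(l ^ k.+1).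
Proof.
rewrite -(ladic_coh x k) -(ladic_coh y k) -natrD -[RHS]ladic_red_nat natrD.
by rewrite !natr_Zp.
Qed.
Definition ladic_add x y := Ladic (fun k => x k + y k) (ladic_add_coh x y).

Fact ladic_mul_coh x y k :
  (nat_of_ord (x k.+1 * y k.+1))%:R = x k * y k :> 'Z_(l ^ k.+1).
Proof.
rewrite -(ladic_coh x k) -(ladic_coh y k) -natrM -[RHS]ladic_red_nat natrM.
by rewrite !natr_Zp.
Qed.
Definition ladic_mul x y := Ladic (fun k => x k * y k) (ladic_mul_coh x y).

Fact ladic_opp_coh x k :
  (nat_of_ord (- x k.+1))%:R = - x k :> 'Z_(l ^ k.+1).
Proof.
apply: (addrI (x k)); rewrite subrr -{1}(ladic_coh x k) -natrD -[LHS]ladic_red_nat.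
by rewrite natrD !natr_Zp subrr.
Qed.
Definition ladic_opp x := Ladic (fun k => - x k) (ladic_opp_coh x).

Fact ladic_addA : associative ladic_add.
Proof. by move=> x y z; apply: ladicP => k /=; rewrite addrA. Qed.
Fact ladic_addC : commutative ladic_add.
Proof. by move=> x y; apply: ladicP => k /=; rewrite addrC. Qed.
Fact ladic_add0 : left_id ladic0 ladic_add.
Proof. by move=> x; apply: ladicP => k /=; rewrite add0r. Qed.
Fact ladic_addN : left_inverse ladic0 ladic_opp ladic_add.
Proof. by move=> x; apply: ladicP => k /=; rewrite addNr. Qed.

HB.instance Definition _ :=
  GRing.isZmodule.Build (ladic l) ladic_addA ladic_addC ladic_add0 ladic_addN.

Fact ladic_mulA : associative ladic_mul.
Proof. by move=> x y z; apply: ladicP => k /=; rewrite mulrA. Qed.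
Fact ladic_mulC : commutative ladic_mul.
Proof. by move=> x y; apply: ladicP => k /=; rewrite mulrC. Qed.
Fact ladic_mul1 : left_id ladic1 ladic_mul.
Proof. by move=> x; apply: ladicP => k /=; rewrite mul1r. Qed.
Fact ladic_mulD : left_distributive ladic_mul ladic_add.
Proof. by move=> x y z; apply: ladicP => k /=; rewrite mulrDl. Qed.
Fact ladic_1neq0 : ladic1 != 0 :> ladic l.
Proof. by apply/eqP => /(congr1 (fun x : ladic l => x 0)). Qed.

HB.instance Definition _ :=
  GRing.Zmodule_isComNzRing.Build (ladic l)
    ladic_mulA ladic_mulC ladic_mul1 ladic_mulD ladic_1neq0.

Lemma ladic_resD x y k : (x + y) k = x k + y k. Proof. by []. Qed.
Lemma ladic_resM x y k : (x * y) k = x k * y k. Proof. by []. Qed.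

Lemma ladic_resX x m k : (x ^+ m) k = x k ^+ m.
Proof. by elim: m => // m IH; rewrite !exprS ladic_resM IH. Qed.

Lemma ladic_res_nat m k : (m%:R : ladic l) k = m%:R.
Proof. by elim: m => // m IH; rewrite !mulrS ladic_resD IH. Qed.

End LadicRing.

Lemma expn_eq1_mod m d a :
  (d %| m)%N -> a = 1 %[mod m] -> (a ^ d = 1 %[mod m * d])%N.
Proof.
case: a => [|a] dm.
  move/eqP; rewrite eq_sym eqn_mod_dvd // subn0 dvdn1 => /eqP m1.
  by move: dm; rewrite m1 dvdn1 => /eqP->; rewrite !modn1.
move/eqP; rewrite eqn_mod_dvd // => am.
have a1 j : (a.+1 ^ j = 1 %[mod d])%N.
  have ad : a.+1 = 1 %[mod d].
    by apply/eqP; rewrite eqn_mod_dvd // (dvdn_trans dm am).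
  by rewrite -modnXm ad modnXm exp1n.
apply/eqP; rewrite eqn_mod_dvd ?expn_gt0 // -[X in (_ - X)%N](exp1n d) subn_exp.
apply: dvdn_mul => //; rewrite /dvdn.
rewrite -modn_summ (eq_bigr (fun=> 1 %% d)%N); last first.
  by move=> i _; rewrite exp1n muln1 a1.
by rewrite modn_summ sum1_card card_ord modnn.
Qed.

Lemma ladic_one_unit l (u : ladic l) k :
  u 0 == 1 -> u k ^+ (Zp_trunc (l ^ k.+1)).+2 = 1.
Proof.
move=> /eqP u0; case: l u u0 => [|[|l]] u u0.
- have -> : u k = 1; last by rewrite expr1n.
  elim: k => // k IH; move: (ladic_coh u k); rewrite IH => /eqP.
  rewrite -{2}[1]/(1%:R) => /natr_Zp_eqP; move: (u k.+1).
  by rewrite !exp0n // => x h; apply: val_inj; rewrite /= -[RHS]h modn_small.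
- have -> : u k = 1; last by rewrite expr1n.
  elim: k => // k IH; move: (ladic_coh u k); rewrite IH => /eqP.
  rewrite -{2}[1]/(1%:R) => /natr_Zp_eqP; move: (u k.+1).
  by rewrite !exp1n // => x h; apply: val_inj; rewrite /= -[RHS]h modn_small.
have l1 j : (1 < l.+2 ^ j.+1)%N by rewrite -[1%N](expn0 l.+2) ltn_exp2l.
have uk1 : nat_of_ord (u k) = 1 %[mod l.+2].
  elim: k => [|k IH]; first by rewrite u0.
  rewrite -IH -(ladic_coh u k) val_Zp_nat // modn_dvdm //.
  by rewrite expnS dvdn_mulr.
rewrite -(natr_Zp (u k)) -natrX -[1]/(1%:R).
move: (nat_of_ord (u k)) uk1 => a a1; apply/eqP/natr_Zp_eqP.
rewrite !Zp_cast //.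
suff h j : a ^ (l.+2 ^ j) = 1 %[mod l.+2 ^ j.+1].
  have -> : (a ^ (l.+2 ^ k.+1) = (a ^ (l.+2 ^ k)) ^ l.+2)%N.
    by rewrite -expnM -expnSr.
  by rewrite -modnXm h modnXm exp1n.
elim: j => [|j IH]; first by rewrite expn0 !expn1.
have -> : (a ^ (l.+2 ^ j.+1) = (a ^ (l.+2 ^ j)) ^ l.+2)%N.
  by rewrite -expnM -expnSr.
by rewrite [(l.+2 ^ j.+2)%N]expnSr; apply: expn_eq1_mod; rewrite // expnS dvdn_mulr.
Qed.

Section LadicPow.
Variables (l : nat) (u x : ladic l) (u1 : u 0 == 1).

(* The powers u ^ a, for u = 1 modulo l, depend modulo l^(k+1) only on a modulo
   l^(k+1); the residue x k may thus serve as exponent at level k. *)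
Fact ladic_pow_coh k :
  (nat_of_ord (u k.+1 ^+ nat_of_ord (x k.+1)))%:R
    = u k ^+ nat_of_ord (x k) :> 'Z_(l ^ k.+1).
Proof.
rewrite -(natr_Zp (u k.+1)) -natrX ladic_red_nat natrX.
rewrite ladic_coh -(ladic_coh x k) Zp_nat /=.
by rewrite expr_mod // ladic_one_unit.
Qed.

Definition ladic_one_unit_pow : ladic l :=
  Ladic (fun k => u k ^+ nat_of_ord (x k)) ladic_pow_coh.
End LadicPow.

(* u ^ x for u, x l-adic integers with u = 1 modulo l; the junk value 1 is
   returned for the other u. *)
Definition ladic_pow l (u x : ladic l) : ladic l :=
  if pselect (u 0 == 1) is left u1 then ladic_one_unit_pow x u1 else 1.

Lemma ladic_powE l (u x : ladic l) k :
  u 0 == 1 -> ladic_pow u x k = u k ^+ nat_of_ord (x k).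
Proof. by rewrite /ladic_pow; case: pselect. Qed.

Lemma ladic_pow_nat l (u : ladic l) m :
  u 0 == 1 -> ladic_pow u m%:R = u ^+ m.
Proof.
move=> u1; apply: ladicP => k; rewrite ladic_powE // ladic_resX ladic_res_nat.
by rewrite Zp_nat /= expr_mod // ladic_one_unit.
Qed.

(* x modulo l ^ m, as a natural number less than l ^ m. *)
Definition ladic_mod l (x : ladic l) (m : nat) : nat :=
  (nat_of_ord (x m) %% l ^ m)%N.

(* z ^ x for z a root of unity whose order is a power of l: with l ^ m the
   order of z, the exponent x is reduced modulo l ^ m. The junk value 1 is
   returned if no z ^+ (l ^ m) is 1. *)
Definition root_pow l (z : algC) (x : ladic l) : algC :=
  match pselect (exists m, z ^+ (l ^ m) == 1) with
  | left ex => z ^+ ladic_mod x (ex_minn ex)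
  | right _ => 1
  end.

Lemma root_pow_nat l (z : algC) m :
  prime l -> (exists j, z ^+ (l ^ j) == 1) -> root_pow z (m%:R : ladic l) = z ^+ m.
Proof.
move=> l_pr zl; rewrite /root_pow; case: pselect => // ex.
case: ex_minnP => j /eqP zj _; rewrite /ladic_mod ladic_res_nat val_Zp_nat.
  by rewrite modn_dvdm ?dvdn_exp2l // expr_mod.
by rewrite -[1%N](expn0 l) ltn_exp2l ?prime_gt1.
Qed.

Definition is_character (q r : nat) (chi : {unit 'Z_q} -> algC) : Prop :=
  [/\ chi 1%g = 1,
      forall x y, chi (x * y)%g = chi x * chi y
    & forall x, chi x ^+ r = 1].

(* chi (m mod q); only meant for m coprime to q, and 0 otherwise. *)
Definition char_nat (q : nat) (chi : {unit 'Z_q} -> algC) (m : nat) : algC :=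
  oapp chi 0 (insub (m%:R : 'Z_q)).

Lemma char_natE q (chi : {unit 'Z_q} -> algC) (x : {unit 'Z_q}) m :
  val x = m%:R -> char_nat chi m = chi x.
Proof. by rewrite /char_nat => <-; rewrite valK. Qed.

Definition gauss_sum (q : nat) (zq : algC) (chi : {unit 'Z_q} -> algC) : algC :=
  - \sum_(x : {unit 'Z_q}) zq ^+ nat_of_ord (val x) * chi x.

(* The subring Z[a, b] of algC. *)
Definition int_adjoin (a b : algC) (x : algC) : Prop :=
  exists P : {poly {poly int}},
    x = (map_poly (map_poly intr) P).[b%:P].[a].

(* The subfield Q(a, b) of algC, that is, the fraction field of Z[a, b]. *)
Definition rat_adjoin (a b : algC) (x : algC) : Prop :=
  exists u v, [/\ int_adjoin a b u, int_adjoin a b v & x = u / v].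

(* s restricts to an automorphism of the subfield K of algC; its values
   outside K are irrelevant. *)
Definition is_field_aut (K : algC -> Prop) (s : algC -> algC) : Prop :=
  [/\ forall x, K x -> K (s x),
      forall y, K y -> exists2 x, K x & s x = y,
      s 1 = 1,
      forall x y, K x -> K y -> s (x + y) = s x + s y
    & forall x y, K x -> K y -> s (x * y) = s x * s y].

(* Equality of the images of x and y, in A, in the quotient ring A / (n). *)
Definition congr_mod (A : algC -> Prop) (n : nat) (x y : algC) : Prop :=
  exists2 z, A z & x - y = n%:R * z.

(* The image of t is a unit of A / (n), with inverse the image of u, and
   s(t) t^(-n) lies in the subgroup of (A / (n))^* generated by the image
   of z, where z is a root of unity. *)
Definition twist_in_cycle (A : algC -> Prop) (n : nat) (s : algC -> algC)
    (t z : algC) : Prop :=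
  exists u i, [/\ A u, congr_mod A n (t * u) 1
    & congr_mod A n (s t * u ^+ n) (z ^+ i)].

(* Main.v *)
(* Write T(a) for the Gaussian sum of chi^a, so that tau = T(1). Raising sums to
   the p-th power modulo p gives T(p^j) = chi(p)^(j p^j) tau^(p^j) mod p, while
   hypothesis (2), iterated through sigma_n, gives
   T(n^j) = eta^(j n^j) tau^(n^j) mod n, where eta^n is the given power of zeta_r.
   Congruences are taken in the ring of all algebraic integers. Taking j with
   r | j and p^j = 1 mod r, the first formula shows that tau^(p^j - 1) = 1 mod p.
   If m is a natural number close l-adically to lambda_p, then p^(l-1) and
   n^((l-1)m) agree modulo a high power of l; comparing the two formulas for
   T(p^(l-1)) = T(n^((l-1)m)) and killing the remaining power of tau by an exponent
   prime to l gives chi(p) = eta^lambda_p, because distinct l-power roots of unity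
   stay distinct modulo p. Multiplying over the prime factors of n with
   multiplicity gives chi(n) = eta^S with n^(l-1) = (n^(l-1))^S l-adically; as
   n > 1, this forces S = 1, so that chi(n) = eta. *)
Require Import Defs.
From mathcomp Require Import all_boot all_order all_algebra all_fingroup all_field.
From mathcomp Require Import cyclic ring.
Set Implicit Arguments.
Unset Strict Implicit.
Unset Printing Implicit Defensive.
Import GRing.Theory.
Local Open Scope ring_scope.

(** * The subring Z[a, b] and its behaviour under automorphisms of Q(a, b) *)

Section IntAdjoin.
Variables a b : algC.
Implicit Types x y : algC.
Local Notation A := (int_adjoin a b).

Lemma int_adjoin0 : A 0.
Proof. by exists 0; rewrite !rmorph0 !horner0. Qed.

Lemma int_adjoin1 : A 1.
Proof. by exists 1; rewrite !rmorph1 !hornerC. Qed.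

Lemma int_adjoin_gen1 : A a.
Proof. by exists ('X)%:P; rewrite map_polyC /= map_polyX !hornerC hornerX. Qed.

Lemma int_adjoin_gen2 : A b.
Proof. by exists 'X; rewrite map_polyX hornerX hornerC. Qed.

Lemma int_adjoinD x y : A x -> A y -> A (x + y).
Proof. by case=> P -> [Q ->]; exists (P + Q); rewrite rmorphD !hornerD. Qed.

Lemma int_adjoinN x : A x -> A (- x).
Proof. by case=> P ->; exists (- P); rewrite rmorphN !hornerN. Qed.

Lemma int_adjoinM x y : A x -> A y -> A (x * y).
Proof. by case=> P -> [Q ->]; exists (P * Q); rewrite rmorphM !hornerM. Qed.

Lemma int_adjoinX x m : A x -> A (x ^+ m).
Proof.
move=> Ax; elim: m => [|m IH]; first exact: int_adjoin1.
by rewrite exprS; apply: int_adjoinM.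
Qed.

(** The closure conditions are restricted to members of Z[a, b] because an automorphism of Q(a, b)
    is known to be additive and multiplicative only inside that field. *)
Lemma int_adjoin_ind (S : algC -> Prop) :
    S 1 -> S a -> S b -> (forall x y, A x -> A y -> S x -> S y -> S (x - y)) ->
    (forall x y, A x -> A y -> S x -> S y -> S (x * y)) ->
  forall x, A x -> S x.
Proof.
move=> S1 Sa Sb SB SM.
have S0 : S 0 by rewrite -(subrr 1); apply: SB => //; apply: int_adjoin1.
have SD x y : A x -> A y -> S x -> S y -> S (x + y).
  move=> Ax Ay Sx Sy; rewrite -[y]opprK -(sub0r y).
  apply: (SB) => //; last by apply: (SB) => //; apply: int_adjoin0.
  by rewrite sub0r; apply: int_adjoinN.
suff SP (P : {poly {poly int}}) : S (map_poly (map_poly intr) P).[b%:P].[a].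
  by move=> x [P ->].
have Sz (m : int) : A m%:~R /\ S m%:~R.
  elim/int_rec: m => [|m [Am Sm]|m [Am Sm]].
  - by split=> //; apply: int_adjoin0.
  - rewrite intS rmorphD /=; split; first by apply: int_adjoinD => //; apply: int_adjoin1.
    by apply: SD => //; apply: int_adjoin1.
  rewrite intS opprD rmorphD /=; split.
    by apply: int_adjoinD => //; apply/int_adjoinN/int_adjoin1.
  rewrite rmorphN /= addrC; apply: SB => //; apply: int_adjoin1.
(* In [P] the inner variable stands for [a] and the outer one for [b]; the coefficients, polynomials
   in [a], are treated first. *)
have SQ (Q : {poly int}) : A (map_poly intr Q).[a] /\ S (map_poly intr Q).[a].
  elim/poly_ind: Q => [|Q c [AQ SQ]].
    by rewrite rmorph0 horner0; split=> //; apply: int_adjoin0.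
  rewrite rmorphD rmorphM /= map_polyX map_polyC /= hornerMXaddC.
  have [Ac Sc] := Sz c; have Aa := int_adjoin_gen1; have AQa := int_adjoinM AQ Aa.
  by split; [apply: int_adjoinD | apply: SD => //; apply: SM].
elim/poly_ind: P => [|P c SP]; first by rewrite rmorph0 !horner0.
have [Ac Sc] := SQ c; have Ab := int_adjoin_gen2.
rewrite rmorphD rmorphM /= map_polyX map_polyC /= hornerMXaddC hornerD hornerM hornerC.
have AP : A (map_poly (map_poly intr) P).[b%:P].[a] by exists P.
by apply: SD => //; [apply: int_adjoinM | apply: SM].
Qed.

Lemma int_adjoin_Aint : a \in Aint -> b \in Aint -> forall x, A x -> x \in Aint.
Proof.
move=> Za Zb; apply: int_adjoin_ind => // [x y _ _ | x y _ _].
  exact: rpredB.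
exact: rpredM.
Qed.

Lemma int_adjoin_sum (I : finType) (F : I -> algC) :
  (forall i, A (F i)) -> A (\sum_i F i).
Proof.
by move=> AF; apply: big_ind => //; [apply: int_adjoin0 | apply: int_adjoinD].
Qed.

Lemma int_rat_adjoin x : A x -> rat_adjoin a b x.
Proof. by move=> Ax; exists x, 1; rewrite divr1; split=> //; apply: int_adjoin1. Qed.

Section Aut.
Variable s : algC -> algC.
Hypothesis s_aut : is_field_aut (rat_adjoin a b) s.

Lemma int_adjoin_autD x y : A x -> A y -> s (x + y) = s x + s y.
Proof. by case: s_aut => _ _ _ sD _ Ax Ay; apply: sD; apply: int_rat_adjoin. Qed.

Lemma int_adjoin_autM x y : A x -> A y -> s (x * y) = s x * s y.
Proof. by case: s_aut => _ _ _ _ sM Ax Ay; apply: sM; apply: int_rat_adjoin. Qed.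

Lemma int_adjoin_aut1 : s 1 = 1.
Proof. by case: s_aut. Qed.

Lemma int_adjoin_aut0 : s 0 = 0.
Proof.
by apply: (addrI (s 0)); rewrite -int_adjoin_autD ?addr0 //; apply: int_adjoin0.
Qed.

Lemma int_adjoin_autN x : A x -> s (- x) = - s x.
Proof.
move=> Ax; apply: (addrI (s x)); rewrite -int_adjoin_autD ?subrr ?int_adjoin_aut0 //.
exact: int_adjoinN.
Qed.

Lemma int_adjoin_autB x y : A x -> A y -> s (x - y) = s x - s y.
Proof.
by move=> Ax Ay; rewrite int_adjoin_autD ?int_adjoin_autN //; apply: int_adjoinN.
Qed.

Lemma int_adjoin_autX x m : A x -> s (x ^+ m) = s x ^+ m.
Proof.
move=> Ax; elim: m => [|m IH]; first exact: int_adjoin_aut1.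
by rewrite !exprS int_adjoin_autM ?IH //; apply: int_adjoinX.
Qed.

Lemma int_adjoin_nat m : A m%:R.
Proof.
elim: m => [|m IH]; first exact: int_adjoin0.
by rewrite mulrS; apply: int_adjoinD => //; apply: int_adjoin1.
Qed.

Lemma int_adjoin_aut_nat m : s m%:R = m%:R.
Proof.
elim: m => [|m IH]; first exact: int_adjoin_aut0.
rewrite mulrS int_adjoin_autD ?int_adjoin_aut1 ?IH //; first exact: int_adjoin1.
exact: int_adjoin_nat.
Qed.

Lemma int_adjoin_aut_sum (I : finType) (F : I -> algC) :
  (forall i, A (F i)) -> s (\sum_i F i) = \sum_i s (F i).
Proof.
move=> AF; suff [] : A (\sum_i F i) /\ s (\sum_i F i) = \sum_i s (F i) by [].
apply: (big_rec2 (fun x y => A y /\ s y = x)).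
  by split; [apply: int_adjoin0 | apply: int_adjoin_aut0].
move=> i y x _ [Ax <-]; split; first exact: int_adjoinD.
exact: int_adjoin_autD.
Qed.

(** An automorphism of Q(a, b) need not preserve Z[a, b]; once it sends the generators into Z[a, b],
    the elements with image there form a subring containing them. *)
Lemma int_adjoin_aut_closed :
  A (s a) -> A (s b) -> forall x, A x -> A (s x).
Proof.
move=> Asa Asb; apply: int_adjoin_ind => // [|x y Ax Ay Asx Asy|x y Ax Ay Asx Asy].
- by rewrite int_adjoin_aut1; apply: int_adjoin1.
- by rewrite int_adjoin_autB //; apply/int_adjoinD/int_adjoinN.
- by rewrite int_adjoin_autM //; apply: int_adjoinM.
Qed.

End Aut.
End IntAdjoin.

(** * Congruences between algebraic integers, and roots of unity modulo p *)

Section Congruences.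
Implicit Types x y : algC.

Lemma eqAmodX (e : Algebraics.divisor) x y m :
  x \in Aint -> y \in Aint ->
  (x == y %[mod e] -> x ^+ m == y ^+ m %[mod e])%A.
Proof.
move=> Zx Zy xy; elim: m => // m IH; rewrite !exprS.
by apply: eqAmodM => //; apply: rpredX.
Qed.

(** Adding one term at a time reduces this to (a + b)^p = a^p + b^p modulo p, where p divides the
    inner binomial coefficients. *)
Lemma Frobenius_sum_eqAmod (I : finType) (F : I -> algC) p :
  prime p -> (forall i, F i \in Aint) ->
  ((\sum_i F i) ^+ p == \sum_i F i ^+ p %[mod p])%A.
Proof.
move=> p_pr ZF.
pose P x y := [/\ x \in Aint, y \in Aint & (x ^+ p == y %[mod p])%A].
suff [] : P (\sum_i F i) (\sum_i F i ^+ p) by [].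
apply: (big_rec2 P) => [|i x y _ [Zx Zy xy]].
  by rewrite /P rpred0 expr0n eqn0Ngt prime_gt0.
split; rewrite ?rpredD ?rpredX //.
have Zxp : x ^+ p \in Aint by rewrite rpredX.
apply: (@eqAmod_trans _ (F i ^+ p + x ^+ p)); last by rewrite eqAmodDl.
case: p p_pr {P xy} Zxp => // p p_pr Zxp.
rewrite exprDn big_ord_recl big_ord_recr /= /bump /= add1n.
rewrite subn0 subnn expr0 bin0 binn !mulr1 mulr1n mul1r mulr1n.
rewrite addrA -[X in (X + _ == _ %[mod _])%A]addrC -addrA.
rewrite -[X in (_ == X %[mod _])%A]add0r eqAmodDr.
rewrite eqAmod0; apply: rpred_sum => j _.
have /dvdnP[c ->] : (p.+1 %| 'C(p.+1, bump 0 j))%N.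
  by rewrite prime_dvd_bin //= ltnS ltn_ord.
rewrite -eqAmod0 mulrnA -[_ *+ p.+1]mulr_natr eqAmodMl0 // rpredMn //.
by rewrite rpredM // rpredX.
Qed.

(* Otherwise 0 = 1 + w + ... + w^(r-1) would be congruent to r modulo p. *)
Lemma unity_root_eqAmod1 (w : algC) p r :
  ~~ (p %| r)%N -> w ^+ r = 1 -> (w == 1 %[mod p])%A -> w = 1.
Proof.
move=> pr wr w1; apply/eqP; apply: contraNT pr => w_neq1.
case: r wr => [|r] wr; first by rewrite dvdn0.
have Zw : w \in Aint by apply: (@Aint_unity_root r.+1) => //; apply/unity_rootP.
suff : (\sum_(i < r.+1) (1 : algC) == 0 %[mod p])%A.
  by rewrite sumr_const card_ord => r0; rewrite -eqAmod0_nat.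
have : (w - 1) * (\sum_(i < r.+1) w ^+ i) = 0.
  by rewrite -subrX1 wr subrr.
move/eqP; rewrite mulf_eq0 subr_eq0 (negPf w_neq1) /= => /eqP sum0.
rewrite -[X in (_ == X %[mod _])%A]sum0 eqAmod_sym /eqAmod -sumrB.
apply: rpred_sum => i _.
by rewrite -[X in _ - X](expr1n _ i); apply: eqAmodX.
Qed.

(** The inverse of w is an algebraic integer, so v / w is a root of unity congruent to 1 modulo
    p. *)
Lemma unity_root_inj_eqAmod (v w : algC) p r :
  (0 < r)%N -> ~~ (p %| r)%N -> v ^+ r = 1 -> w ^+ r = 1 ->
  (v == w %[mod p])%A -> v = w.
Proof.
move=> r_gt0 pr vr wr vw.
have w_neq0 : w != 0.
  by apply/eqP=> w0; move/eqP: wr; rewrite w0 expr0n eqn0Ngt r_gt0 eq_sym oner_eq0.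
have Zw : w^-1 \in Aint.
  by apply: (Aint_unity_root r_gt0); apply/unity_rootP; rewrite exprVn wr invr1.
suff : v * w^-1 = 1 by move/(canRL (mulfVK w_neq0)); rewrite mul1r.
apply: (@unity_root_eqAmod1 _ p r) => //; first by rewrite exprMn exprVn vr wr invr1 mulr1.
by rewrite -(divff w_neq0); apply: eqAmodMr.
Qed.

End Congruences.

(** * Powers, modulo powers of l, of integers congruent to 1 modulo l *)

Section LadicExponents.
Variable l : nat.
Hypothesis l_pr : prime l.

Lemma prime_exp_gt1 j : (1 < l ^ j.+1)%N.
Proof. by rewrite -[1%N](expn0 l) ltn_exp2l ?prime_gt1. Qed.

Lemma ladic_res_mod (x : ladic l) j i :
  (j <= i)%N -> (x i %% l ^ j.+1 = x j)%N.
Proof.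
move=> /subnK <-; elim: (i - j)%N => [|d IH].
  by rewrite add0n modn_small // -{2}(Zp_cast (prime_exp_gt1 j)).
rewrite addSn -IH -(ladic_coh x (d + j)) val_Zp_nat ?prime_exp_gt1 //.
by rewrite modn_dvdm // dvdn_exp2l // ltnS leq_addl.
Qed.

(** The definition reduces x modulo the exact order l^j of z; as j <= k <= i, the finer residue
    [x i] has the same effect. *)
Lemma root_pow_res (z : algC) (x : ladic l) k i :
  z ^+ (l ^ k) = 1 -> (k <= i)%N -> root_pow z x = z ^+ x i.
Proof.
move=> zk ki; rewrite /root_pow; case: boolp.pselect => [ex|[]]; last by exists k; apply/eqP.
case: ex_minnP => j /eqP zj /(_ k); rewrite zk eqxx => /(_ isT) jk.
rewrite /ladic_mod expr_mod // -(ladic_res_mod x (leq_trans jk ki)).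
by rewrite -[LHS](expr_mod _ zj) modn_dvdm ?expr_mod ?dvdn_exp2l.
Qed.

Lemma natr_Zp_pfactorP i a b :
  ((a%:R : 'Z_(l ^ i.+1)) = b%:R) <-> (a = b %[mod l ^ i.+1]).
Proof.
have := natr_Zp_eqP (l ^ i.+1) a b.
rewrite [in X in reflect X _](Zp_cast (prime_exp_gt1 i)) => ab.
by split=> [/eqP/ab | /ab/eqP].
Qed.

Lemma one_unit_natX (g i : nat) :
  g = 1 %[mod l] -> (g%:R : 'Z_(l ^ i.+1)) ^+ (l ^ i.+1) = 1.
Proof.
move=> g1; have := @ladic_one_unit l g%:R i.
rewrite !ladic_res_nat [in X in _ ^+ X](Zp_cast (prime_exp_gt1 i)); apply; apply/eqP.
by rewrite -[1]/(1%:R); apply/natr_Zp_pfactorP; rewrite expn1.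
Qed.

(** Turns hypothesis (1) into congruences between natural numbers, one for each level. *)
Lemma ladic_pow_nat_eqmod (g h i : nat) (x : ladic l) :
  g = 1 %[mod l] -> h%:R = ladic_pow g%:R x ->
  h = (g ^ x i)%N %[mod l ^ i.+1].
Proof.
move=> g1 /(congr1 (fun y : ladic l => y i)); rewrite ladic_powE; last first.
  by rewrite ladic_res_nat -[1]/(1%:R); apply/eqP/natr_Zp_pfactorP; rewrite expn1.
by rewrite !ladic_res_nat -natrX => /natr_Zp_pfactorP.
Qed.

(* The order of g modulo a power of l is a power of l; it cannot stay below l^k
   once the modulus exceeds g^(l^k). *)
Lemma dvdn_one_unit_exponent (g k i D : nat) :
  (1 < g)%N -> g = 1 %[mod l] -> (g ^ l ^ k <= i)%N ->
  (g%:R : 'Z_(l ^ i.+1)) ^+ D = 1 -> (l ^ k %| D)%N.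
Proof.
move=> g_gt1 g1 gi gD; case: (posnP D) => [-> //|D_gt0].
have gl := one_unit_natX i g1.
have [v _ Dv] : exists2 v, (v <= i.+1)%N & gcdn D (l ^ i.+1) = (l ^ v)%N.
  by apply/dvdn_pfactor; rewrite ?dvdn_gcdr.
(* Bezout: the exponents D and l^(i+1) both send g to 1, hence so does their gcd l^v. *)
have [u u' Du _] := egcdnP (l ^ i.+1) D_gt0.
have gv : (g%:R : 'Z_(l ^ i.+1)) ^+ (l ^ v) = 1.
  have := congr1 (fun m => (g%:R : 'Z_(l ^ i.+1)) ^+ m) Du.
  by rewrite /= exprD mulnC exprM gD expr1n mulnC exprM gl expr1n mul1r Dv.
have [kv|vk] := leqP k v.
  by apply: dvdn_trans (dvdn_gcdl D (l ^ i.+1)); rewrite Dv dvdn_exp2l.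
have : (g ^ l ^ k)%N = 1 %[mod l ^ i.+1].
  apply/natr_Zp_pfactorP; rewrite natrX -(subnKC (ltnW vk)) expnD exprM gv.
  by rewrite expr1n.
have gk_gt1 : (1 < g ^ l ^ k)%N.
  by rewrite -[1%N](expn0 g) ltn_exp2l // expn_gt0 prime_gt0.
move/eqP; rewrite eqn_mod_dvd ?(ltnW gk_gt1) // => /dvdn_leq.
rewrite subn_gt0 => /(_ gk_gt1); rewrite leqNgt => /negP[].
apply: leq_ltn_trans (leq_subr _ _) (leq_ltn_trans gi (ltn_trans (ltnSn i) _)).
by rewrite ltn_expl ?prime_gt1.
Qed.

(** Cancelling the unit g leaves g^(S-1) = 1, and the bound on the order of g gives l^k | S - 1. *)
Lemma one_unit_exponent_eq1 (g k i S : nat) :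
  (1 < g)%N -> g = 1 %[mod l] -> (k <= i)%N -> (g ^ l ^ k <= i)%N ->
  (g ^ S)%N = g %[mod l ^ i.+1] -> S = 1 %[mod l ^ k].
Proof.
move=> g_gt1 g1 ki gi /natr_Zp_pfactorP gS.
have gl := one_unit_natX i g1.
(* S may be 0; adding l^(i+1) allows a predecessor and changes neither the power of g nor S modulo
   l^k. *)
have Sl_gt0 : (0 < S + l ^ i.+1)%N by rewrite addn_gt0 expn_gt0 (prime_gt0 l_pr) orbT.
have : (l ^ k %| (S + l ^ i.+1).-1)%N.
  apply: (dvdn_one_unit_exponent g_gt1 g1 gi).
  have gU : (g%:R : 'Z_(l ^ i.+1)) \is a GRing.unit.
    by rewrite -(unitrX_pos _ (ltnW (prime_exp_gt1 i))) gl unitr1.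
  by apply: (mulrI gU); rewrite -exprS prednK // exprD gl mulr1 -natrX gS mulr1.
rewrite -subn1 -eqn_mod_dvd // => /eqP <-.
by rewrite -[RHS]modnDmr (eqP (dvdn_exp2l l (leq_trans ki (leqnSn i)))) addn0.
Qed.

End LadicExponents.

(** * Values of the character at natural numbers prime to q *)

Section CharNat.
Variables (q r : nat) (chi : {unit 'Z_q} -> algC).
Hypotheses (q_gt1 : (1 < q)%N) (chiP : is_character r chi).

Lemma char_nat_unit m :
  coprime q m -> exists2 x : {unit 'Z_q}, val x = m%:R & char_nat chi m = chi x.
Proof.
rewrite -unitZpE // => mU; exists (FinRing.unit 'Z_q mU) => //.
exact: char_natE.
Qed.

Lemma char_natM a b :
  coprime q a -> coprime q b -> char_nat chi (a * b) = char_nat chi a * char_nat chi b.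
Proof.
move=> /char_nat_unit[x Dx ->] /char_nat_unit[y Dy ->].
case: chiP => _ chiM _; rewrite -chiM; apply: char_natE.
by rewrite natrM -Dx -Dy.
Qed.

Lemma char_nat1 : char_nat chi 1 = 1.
Proof. by case: chiP => <- _ _; apply: char_natE. Qed.

End CharNat.

(** * Gaussian sums of powers of chi, and Frobenius modulo p *)

Section GaussSumPowers.
Variables (q r : nat) (chi : {unit 'Z_q} -> algC) (zq : algC).
Hypotheses (q_gt1 : (1 < q)%N) (r_gt0 : (0 < r)%N).
Hypotheses (chiP : is_character r chi) (zqP : q.-primitive_root zq).

Local Notation T a := (gauss_sum zq (fun x => chi x ^+ a)).

Lemma character_Aint x : chi x \in Aint.
Proof.
by case: chiP => _ _ chi_r; apply: (Aint_unity_root r_gt0); apply/unity_rootP.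
Qed.

Lemma gauss_sum_Aint a : T a \in Aint.
Proof.
rewrite rpredN; apply: rpred_sum => x _; apply: rpredM.
  by apply/rpredX/(Aint_prim_root zqP).
exact/rpredX/character_Aint.
Qed.

Lemma eq_gauss_sum_mod a b : a = b %[mod r] -> T a = T b.
Proof.
case: chiP => _ _ chi_r ab; congr (- _); apply: eq_bigr => x _.
by rewrite -(expr_mod a (chi_r x)) ab expr_mod.
Qed.

(** Replacing the summation variable y by x y, with x the class of p, extracts chi(p)^(a p) and
    leaves the sum of the p-th powers of the terms of [T a]. *)
Lemma gauss_sum_Frobenius p (x : {unit 'Z_q}) a :
  prime p -> val x = p%:R ->
  (T (a * p) == chi x ^+ (a * p) * T a ^+ p %[mod p])%A.
Proof.
case: (chiP) => _ chiM _ p_pr Dx.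
pose F y := zq ^+ nat_of_ord (val y) * chi y ^+ a.
have ZF y : F y \in Aint.
  apply: rpredM; first by apply/rpredX/(Aint_prim_root zqP).
  exact/rpredX/character_Aint.
have -> : T (a * p) = - (chi x ^+ (a * p) * \sum_y F y ^+ p).
  congr (- _); rewrite (reindex_inj (mulgI x)) mulr_sumr; apply: eq_bigr => y _.
  rewrite chiM exprMn mulrCA [F y ^+ p]exprMn exprM; congr (_ * (_ * _)).
    rewrite -exprM -[RHS](prim_expr_mod zqP); congr (_ ^+ _).
    by rewrite mulnC -val_Zp_nat // natrM natr_Zp -Dx.
  by rewrite exprM.
rewrite -mulrN; apply: eqAmodMl; first exact/rpredX/character_Aint.
rewrite eqAmod_sym.
have pF := Frobenius_sum_eqAmod p_pr ZF.
have ZSp : \sum_y F y ^+ p \in Aint by apply: rpred_sum => y _; apply: rpredX.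
(* The sign in the Gaussian sum survives an odd power; for p = 2, signs do not matter modulo 2. *)
have [p2|p_odd] := even_prime p_pr; last first.
  by rewrite exprNn -signr_odd p_odd expr1 mulN1r eqAmodN opprK.
rewrite p2 in pF ZSp *; rewrite sqrrN; apply: eqAmod_trans pF _.
by rewrite /eqAmod opprK -mulr2n -mulr_natr -eqAmod0 eqAmodMl0.
Qed.

(** Raising the formula for j to the p-th power turns the exponent j p^j into j p^(j+1), and the new
    factor adds p^(j+1). *)
Lemma gauss_sum_iter_Frobenius p (x : {unit 'Z_q}) j :
  prime p -> val x = p%:R ->
  (T (p ^ j) == chi x ^+ (j * p ^ j) * T 1 ^+ (p ^ j) %[mod p])%A.
Proof.
move=> p_pr Dx; elim: j => [|j IH]; first by rewrite mul0n !expr0 mul1r expr1.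
rewrite expnSr; apply: eqAmod_trans (gauss_sum_Frobenius _ p_pr Dx) _.
have Zx m : chi x ^+ m \in Aint by apply/rpredX/character_Aint.
have ZT m : T 1 ^+ m \in Aint by apply/rpredX/gauss_sum_Aint.
rewrite mulSn exprD -mulrA; apply: eqAmodMl => //.
apply: eqAmod_trans (eqAmodX p (gauss_sum_Aint _) _ IH) _.
  exact: rpredM.
by rewrite exprMn -!exprM mulnA.
Qed.

End GaussSumPowers.

(** * Cancelling exponents and inverses, and passing from modulus n to a divisor p *)

Lemma eqAmodX_mod (e : Algebraics.divisor) (x : algC) f a b :
  x \in Aint -> (x ^+ f == 1 %[mod e])%A -> a = b %[mod f] ->
  (x ^+ a == x ^+ b %[mod e])%A.
Proof.
move=> Zx xf ab; suff h c : (x ^+ c == x ^+ (c %% f) %[mod e])%A.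
  by apply: eqAmod_trans (h a) _; rewrite eqAmod_sym ab.
rewrite {1}(divn_eq c f) exprD mulnC exprM -[X in (_ == X %[mod _])%A]mul1r.
apply: eqAmodMr; first exact: rpredX.
by rewrite -(expr1n _ (c %/ f)); apply: eqAmodX; rewrite ?rpredX.
Qed.

(** By Euler, c^(phi(r)-1) is inverse to c modulo r, so z is recovered from z^c. *)
Lemma unity_root_exp_inj (v w : algC) c r :
  (0 < r)%N -> coprime c r -> v ^+ r = 1 -> w ^+ r = 1 -> v ^+ c = w ^+ c -> v = w.
Proof.
move=> r_gt0 cr vr wr vw.
have h (z : algC) : z ^+ r = 1 -> z = (z ^+ c) ^+ (c ^ (totient r).-1).
  move=> zr; rewrite -exprM -expnS prednK ?totient_gt0 // -(expr_mod _ zr).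
  by rewrite Euler_exp_totient // expr_mod.
by rewrite (h v) // (h w) // vw.
Qed.

Lemma congr_mod_eqAmod (A : algC -> Prop) n p x y :
  (forall z, A z -> z \in Aint) -> (p %| n)%N ->
  congr_mod A n x y -> (x == y %[mod p])%A.
Proof.
move=> ZA /dvdnP[m ->] [z /ZA Zz xy]; rewrite /eqAmod xy natrM mulrAC -eqAmod0.
by rewrite eqAmodMl0 // rpredM // rpred_nat.
Qed.

(** Frees hypothesis (2) from the inverse u of the Gaussian sum t. *)
Lemma int_adjoin_congr_div (a b : algC) n t u x y :
  int_adjoin a b t -> int_adjoin a b u -> int_adjoin a b x ->
  congr_mod (int_adjoin a b) n (t * u) 1 ->
  congr_mod (int_adjoin a b) n (x * u ^+ n) y ->
  congr_mod (int_adjoin a b) n x (y * t ^+ n).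
Proof.
move=> At Au Ax [z Az tu1] [w Aw xuy].
(* From x - y t^n = t^n (x u^n - y) - x ((t u)^n - 1), where (t u)^n - 1 is t u - 1 = n z times a
   geometric sum. *)
exists (t ^+ n * w - x * (z * \sum_(i < n) (t * u) ^+ i)).
  apply: int_adjoinD; first by apply: int_adjoinM => //; apply: int_adjoinX.
  apply/int_adjoinN/int_adjoinM/int_adjoinM => //; apply: int_adjoin_sum => i.
  by apply/int_adjoinX/int_adjoinM.
rewrite mulrBr [n%:R * (x * _)]mulrCA [n%:R * (z * _)]mulrA -tu1 mulrCA -xuy.
by rewrite -subrX1 exprMn; ring.
Qed.

(** * Gaussian sums under sigma_n, and the iteration of hypothesis (2) *)

Section GaussSumTwist.
Variables (q r : nat) (chi : {unit 'Z_q} -> algC) (zq zr : algC).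
Hypotheses (q_gt1 : (1 < q)%N) (chiP : is_character r chi).
Hypotheses (zqP : q.-primitive_root zq) (zrP : r.-primitive_root zr).
Variables (n : nat) (s : algC -> algC).
Hypothesis s_aut : is_field_aut (rat_adjoin zq zr) s.
Hypotheses (s_zr : s zr = zr ^+ n) (s_zq : s zq = zq).

Local Notation A := (int_adjoin zq zr).
Local Notation T a := (gauss_sum zq (fun x => chi x ^+ a)).

Let Azq : A zq := int_adjoin_gen1 zq zr.
Let Azr : A zr := int_adjoin_gen2 zq zr.

Lemma character_prim_root x : exists i, chi x = zr ^+ i.
Proof.
by case: chiP => _ _ chi_r; have [i ->] := prim_rootP zrP (chi_r x); exists i.
Qed.

Lemma gauss_term_int_adjoin a x : A (zq ^+ nat_of_ord (val x) * chi x ^+ a).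
Proof.
by have [i ->] := character_prim_root x; apply: int_adjoinM; do !apply: int_adjoinX.
Qed.

Lemma gauss_sum_int_adjoin a : A (T a).
Proof. by apply/int_adjoinN/int_adjoin_sum/gauss_term_int_adjoin. Qed.

Lemma aut_prim_exp i : s (zr ^+ i) = (zr ^+ i) ^+ n.
Proof. by rewrite (int_adjoin_autX s_aut) // s_zr exprAC. Qed.

(** [s] fixes [zq] and raises the values of chi, which are powers of [zr], to the n-th power. *)
Lemma aut_gauss_sum a : s (T a) = T (n * a).
Proof.
have AT := gauss_term_int_adjoin a.
rewrite (int_adjoin_autN s_aut); last exact: int_adjoin_sum.
congr (- _); rewrite (int_adjoin_aut_sum s_aut) //; apply: eq_bigr => x _.
have [i ->] := character_prim_root x.
rewrite (int_adjoin_autM s_aut); try by do !apply: int_adjoinX.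
rewrite -exprM aut_prim_exp (int_adjoin_autX s_aut) // s_zq.
by rewrite -!exprM [(n * a)%N]mulnC mulnA.
Qed.

Lemma aut_congr_mod x y : A x -> A y -> congr_mod A n x y -> congr_mod A n (s x) (s y).
Proof.
move=> Ax Ay [z Az xy]; exists (s z).
  apply: (int_adjoin_aut_closed s_aut) Az; rewrite ?s_zq ?s_zr //.
  exact: int_adjoinX.
rewrite -(int_adjoin_autB s_aut) // xy (int_adjoin_autM s_aut) //.
  by rewrite (int_adjoin_aut_nat s_aut).
exact: int_adjoin_nat.
Qed.

Lemma gauss_sum_iter_twist p i j :
  (p %| n)%N -> congr_mod A n (T n) ((zr ^+ i) ^+ n * T 1 ^+ n) ->
  (T (n ^ j) == (zr ^+ i) ^+ (j * n ^ j) * T 1 ^+ (n ^ j) %[mod p])%A.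
Proof.
move=> pn Tn.
(* The hypothesis with [s] applied m times. This takes place modulo n in Z[zq, zr], which [s]
   preserves; the passage to p comes afterwards. *)
have step m : congr_mod A n (T (n ^ m.+1)) ((zr ^+ i) ^+ (n ^ m.+1) * T (n ^ m) ^+ n).
  elim: m => [|m IH]; first by rewrite expn1.
  have Ae c : A ((zr ^+ i) ^+ c) by do 2!apply: int_adjoinX.
  have AT c : A (T c ^+ n) by apply/int_adjoinX/gauss_sum_int_adjoin.
  have := aut_congr_mod (gauss_sum_int_adjoin _) (int_adjoinM (Ae _) (AT _)) IH.
  rewrite (int_adjoin_autM s_aut) // (int_adjoin_autX s_aut _ (gauss_sum_int_adjoin _)).
  by rewrite !aut_gauss_sum -!expnS -exprM aut_prim_exp -!exprM -mulnA -expnSr.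
have ZA := int_adjoin_Aint (Aint_prim_root zqP) (Aint_prim_root zrP).
have ZT c : T c \in Aint by apply/ZA/gauss_sum_int_adjoin.
have Ze c : (zr ^+ i) ^+ c \in Aint by apply/rpredX/rpredX/(Aint_prim_root zrP).
elim: j => [|j IH]; first by rewrite mul0n !expr0 mul1r expr1.
apply: eqAmod_trans (congr_mod_eqAmod ZA pn (step j)) _.
rewrite mulSn exprD -mulrA; apply: eqAmodMl => //.
apply: eqAmod_trans (eqAmodX n (ZT _) _ IH) _.
  exact: rpredM (Ze _) (rpredX _ (ZT _)).
by rewrite exprMn -[X in X * _]exprM -[X in _ * X]exprM -mulnA -expnSr.
Qed.

End GaussSumTwist.

(** * The value of chi at a prime divisor p of n *)

Section PrimeDivisor.
Variables (q l k : nat) (chi : {unit 'Z_q} -> algC) (zq : algC).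
Hypotheses (q_gt1 : (1 < q)%N) (l_pr : prime l).
Hypotheses (chiP : is_character (l ^ k) chi) (zqP : q.-primitive_root zq).
Variables (p : nat) (x : {unit 'Z_q}).
Hypotheses (p_pr : prime p) (p_neq_l : ~~ (p %| l ^ k)%N) (Dx : val x = p%:R).
Variable u : algC.

Local Notation T a := (gauss_sum zq (fun x => chi x ^+ a)).
Hypotheses (Zu : u \in Aint) (Tu : (T 1 * u == 1 %[mod p])%A).

Let r_gt0 : (0 < l ^ k)%N. Proof. by rewrite expn_gt0 prime_gt0. Qed.
Let ZT a : T a \in Aint := gauss_sum_Aint r_gt0 chiP zqP a.

Lemma gauss_sum_mul_inv m : (T 1 ^+ m * u ^+ m == 1 %[mod p])%A.
Proof.
by rewrite -exprMn -(expr1n _ m); apply: eqAmodX; rewrite ?rpredM.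
Qed.

Lemma coprime_prime_pow : coprime p (l ^ k).
Proof. by rewrite prime_coprime. Qed.

Lemma gauss_sum_finite_order : exists2 f, (0 < f)%N & (T 1 ^+ f == 1 %[mod p])%A.
Proof.
(* The factor l^k of e makes the power of [chi x] trivial; the totient gives p^e = 1 modulo l^k, so
   that T(p^e) = T(1). *)
pose e := (l ^ k * totient (l ^ k))%N.
have e_gt0 : (0 < e)%N by rewrite muln_gt0 totient_gt0 r_gt0.
have pe_gt1 : (1 < p ^ e)%N by rewrite -[1%N](expn0 p) ltn_exp2l ?prime_gt1.
exists (p ^ e).-1; first by rewrite -subn1 subn_gt0.
have pe1 : p ^ e = 1 %[mod l ^ k].
  by rewrite /e mulnC expnM -modnXm Euler_exp_totient ?coprime_prime_pow // modnXm exp1n.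
have := gauss_sum_iter_Frobenius q_gt1 r_gt0 chiP zqP e p_pr Dx.
rewrite (eq_gauss_sum_mod zq chiP pe1).
case: (chiP) => _ _ chi_r; rewrite /e -!mulnA exprM chi_r expr1n mul1r => T1.
(* Multiplying by u cancels one factor [T 1]. *)
have {}T1 := eqAmodMr Zu T1.
have := gauss_sum_mul_inv 1; rewrite !expr1 => TU.
rewrite eqAmod_sym; rewrite eqAmod_sym in TU.
apply: eqAmod_trans TU (eqAmod_trans T1 _).
rewrite -/e -[X in _ ^+ X * _](prednK (ltnW pe_gt1)) exprSr -mulrA.
rewrite -[X in (_ == X %[mod _])%A]mulr1; apply: eqAmodMl => //.
exact: rpredX.
Qed.

Variables (n : nat) (eta : algC) (lambda : ladic l).
Hypotheses (eta_r : eta ^+ (l ^ k) = 1).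
Hypothesis Tn : forall j,
  (T (n ^ j) == eta ^+ (j * n ^ j) * T 1 ^+ (n ^ j) %[mod p])%A.
Hypothesis p_lambda : forall i,
  (p ^ (l - 1))%N = ((n ^ (l - 1)) ^ lambda i)%N %[mod l ^ i.+1].

(* Both sides of the two power formulas at a = p^(l-1) and b = n^((l-1)m) are
   congruent. Raising to the part w of the order of T 1 prime to l makes the
   powers of T 1 cancel, and leaves an identity between roots of unity. *)
Lemma character_prime_divisor : chi x = root_pow eta lambda.
Proof.
have [f f_gt0 Tf] := gauss_sum_finite_order.
have [w lw Df] := pfactor_coprime l_pr f_gt0.
(* Here f = w l^t. At level i, a and b agree modulo l^k, which gives T(a) = T(b), and modulo l^t,
   which gives a w = b w modulo f. *)
set t := logn l f in Df; pose i := maxn k t; pose m := nat_of_ord (lambda i).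
rewrite (root_pow_res l_pr lambda eta_r (leq_maxl k t)) -/i -/m.
have pm := p_lambda i; rewrite -/m -expnM in pm.
set a := (p ^ (l - 1))%N in pm; set b := (n ^ _)%N in pm.
have ab j : (j <= i.+1)%N -> a = b %[mod l ^ j].
  move=> ji; rewrite -(modn_dvdm a (dvdn_exp2l l ji)) pm modn_dvdm //.
  exact: dvdn_exp2l.
have abr : a = b %[mod l ^ k] by apply: ab; rewrite leqW ?leq_maxl.
case: (chiP) => _ _ chi_r.
have Zchi c : chi x ^+ c \in Aint by apply/rpredX/(character_Aint r_gt0 chiP).
have Zeta c : eta ^+ c \in Aint.
  by apply/rpredX/(Aint_unity_root r_gt0); apply/unity_rootP.
have ZTX c : T 1 ^+ c \in Aint by apply: rpredX.
have E1 : (chi x ^+ ((l - 1) * a) * T 1 ^+ a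
           == eta ^+ ((l - 1) * m * b) * T 1 ^+ b %[mod p])%A.
  apply: eqAmod_trans (Tn _); rewrite -/b -(eq_gauss_sum_mod zq chiP abr) eqAmod_sym.
  exact: (gauss_sum_iter_Frobenius q_gt1 r_gt0 chiP zqP (l - 1) p_pr Dx).
have {E1} := eqAmodX w (rpredM (Zchi _) (ZTX _)) (rpredM (Zeta _) (ZTX _)) E1.
rewrite !exprMn -!exprM => E1.
have Tab : (T 1 ^+ (a * w) == T 1 ^+ (b * w) %[mod p])%A.
  apply: (eqAmodX_mod (ZT 1) Tf); rewrite Df mulnC [(b * w)%N]mulnC.
  by rewrite -!muln_modr (ab t) // leqW ?leq_maxr.
have E2 : (chi x ^+ ((l - 1) * a * w) == eta ^+ ((l - 1) * m * b * w) %[mod p])%A.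
  have Ub := gauss_sum_mul_inv (b * w).
  have cancel c : c \in Aint -> (c * T 1 ^+ (b * w) * u ^+ (b * w) == c %[mod p])%A.
    move=> Zc; rewrite -mulrA -[X in (_ == X %[mod _])%A]mulr1.
    exact: eqAmodMl.
  have := cancel _ (Zchi ((l - 1) * a * w)%N); rewrite eqAmod_sym => /eqAmod_trans; apply.
  apply: eqAmod_trans _ (cancel _ (Zeta _)); apply: eqAmodMr; first exact: rpredX.
  by apply: eqAmod_trans _ E1; apply: eqAmodMl => //; rewrite eqAmod_sym.
have chic c : (chi x ^+ c) ^+ (l ^ k) = 1 by rewrite exprAC chi_r expr1n.
have etac c : (eta ^+ c) ^+ (l ^ k) = 1 by rewrite exprAC eta_r expr1n.
have {E2} := unity_root_inj_eqAmod r_gt0 p_neq_l (chic _) (etac _) E2.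
(* As a = b modulo l^k, a replaces b in the exponent of eta; then [chi x] and eta^m have the same
   power of exponent (l-1) a w, which is prime to l^k. *)
have -> : ((l - 1) * m * b * w = b * ((l - 1) * m * w))%N by rewrite mulnAC mulnC.
rewrite -(expr_mod _ eta_r) -modnMml -abr modnMml expr_mod //.
have -> : (a * ((l - 1) * m * w) = m * ((l - 1) * a * w))%N.
  by rewrite -!mulnA [LHS]mulnCA [RHS]mulnCA; congr muln; apply: mulnCA.
rewrite [eta ^+ _]exprM; apply: (@unity_root_exp_inj _ _ _ (l ^ k)) => //.
rewrite !coprimeMl; apply/andP; split; last by rewrite coprime_sym coprimeXl.
apply/andP; split; last exact: coprimeXl coprime_prime_pow.
by rewrite subn1 coprimeXr // coprimePn ?prime_gt0.
Qed.

End PrimeDivisor.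

(** * Multiplicativity over the prime factors of n, and the value of chi at n *)

Section Multiplicativity.
Variables (q l k n : nat) (chi : {unit 'Z_q} -> algC) (eta : algC).
Variable lambda : nat -> ladic l.
Hypotheses (q_gt1 : (1 < q)%N) (l_pr : prime l).
Hypotheses (chiP : is_character (l ^ k) chi).
Hypotheses (qn : coprime q n) (ln : coprime l n) (n_gt1 : (1 < n)%N).
Hypothesis eta_r : eta ^+ (l ^ k) = 1.
Hypothesis p_lambda : forall p i, prime p -> (p %| n)%N ->
  (p ^ (l - 1))%N = ((n ^ (l - 1)) ^ lambda p i)%N %[mod l ^ i.+1].
Hypothesis chi_p : forall p, prime p -> (p %| n)%N ->
  char_nat chi p = root_pow eta (lambda p).

(* S is the sum of the lambda p over the prime factors p of d. *)
Lemma char_nat_divisor i d : (k <= i)%N -> (0 < d)%N -> (d %| n)%N ->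
  exists2 S, char_nat chi d = eta ^+ S
    & (d ^ (l - 1))%N = ((n ^ (l - 1)) ^ S)%N %[mod l ^ i.+1].
Proof.
move=> ki; elim/ltn_ind: d => d IH d_gt0 dn.
have [d_le1|d_gt1] := leqP d 1.
  have -> : d = 1%N by apply/eqP; rewrite eqn_leq d_le1.
  by exists 0%N; rewrite ?(char_nat1 chiP) // exp1n.
have p_pr := pdiv_prime d_gt1; have /dvdnP[c Dd] := pdiv_dvd d.
have pn : (pdiv d %| n)%N := dvdn_trans (pdiv_dvd d) dn.
have cn : (c %| n)%N by apply: dvdn_trans dn; rewrite Dd dvdn_mulr.
have c_gt0 : (0 < c)%N by move: d_gt0; rewrite {1}Dd muln_gt0 => /andP[].
have cd : (c < d)%N by rewrite [ltnRHS]Dd ltn_Pmulr ?prime_gt1.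
have [S chiS DS] := IH c cd c_gt0 cn.
exists (S + lambda (pdiv d) i)%N; rewrite {1}Dd.
  rewrite (char_natM q_gt1 chiP) ?(coprime_dvdr _ qn) // chiS chi_p //.
  by rewrite (root_pow_res l_pr _ eta_r ki) exprD.
by rewrite expnMn -modnMm DS p_lambda // modnMm expnD.
Qed.

Lemma char_nat_eq_eta : char_nat chi n = eta.
Proof.
(* The level i is so large that a power of g equal to g modulo l^(i+1) has exponent 1 modulo l^k. *)
pose g := (n ^ (l - 1))%N; pose i := maxn k (g ^ l ^ k).
have n_gt0 := ltnW n_gt1.
have g_gt1 : (1 < g)%N by rewrite -[1%N](expn0 n) ltn_exp2l // subn_gt0 prime_gt1.
have g1 : g = 1 %[mod l].
  by rewrite /g subn1 -totient_prime // Euler_exp_totient // coprime_sym.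
have [S -> DS] := char_nat_divisor (leq_maxl k (g ^ l ^ k)) n_gt0 (dvdnn n).
have S1 := one_unit_exponent_eq1 l_pr g_gt1 g1 (leq_maxl _ _) (leq_maxr _ _) (esym DS).
by rewrite -(expr_mod S eta_r) S1 expr_mod.
Qed.

End Multiplicativity.

(** * Extraction of eta from hypothesis (2), and conclusion *)

Theorem theorem3p2 (n q l k r : nat) (hq : prime q) (hqn : ~~ (q %| n)%N)
    (hl : prime l) (hr : r = (l ^ k)%N) (hln : ~~ (l %| n)%N)
    (chi : {unit 'Z_q} -> algC) (hchi : is_character r chi)
    (zq zr : algC) (hzq : q.-primitive_root zq) (hzr : r.-primitive_root zr)
    (sigma_n : algC -> algC)
    (hsigma : is_field_aut (rat_adjoin zq zr) sigma_n)
    (hsigma_r : sigma_n zr = zr ^+ n) (hsigma_q : sigma_n zq = zq)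
    (lambda : nat -> ladic l)
    (h1 : forall p, prime p -> (p %| n)%N ->
       p%:R ^+ (l - 1) = ladic_pow (n%:R ^+ (l - 1)) (lambda p))
    (h2 : twist_in_cycle (int_adjoin zq zr) n sigma_n (gauss_sum zq chi) zr) :
  forall p, prime p -> (p %| n)%N ->
    char_nat chi p = root_pow (char_nat chi n) (lambda p).
Proof.
have q_gt1 := prime_gt1 hq; rewrite hr in hchi hzr; move=> {r hr}.
have qn : coprime q n by rewrite prime_coprime.
have ln : coprime l n by rewrite prime_coprime.
have r_gt0 : (0 < l ^ k)%N by rewrite expn_gt0 prime_gt0.
have [u [i [Au Tu sT]]] := h2.
have eT : gauss_sum zq chi = gauss_sum zq (fun x => chi x ^+ 1) by [].
set A := int_adjoin zq zr in Au Tu sT.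
have ZA := int_adjoin_Aint (Aint_prim_root hzq) (Aint_prim_root hzr).
(* n^(phi(l^k)-1) inverts n modulo l^k, so eta is an n-th root of zr^i. *)
pose e := (i * n ^ (totient (l ^ k)).-1)%N; pose eta := zr ^+ e.
have zr_r c : (zr ^+ c) ^+ (l ^ k) = 1.
  by rewrite exprAC (prim_expr_order hzr) expr1n.
have eta_r : eta ^+ (l ^ k) = 1 := zr_r e.
have eta_n : eta ^+ n = zr ^+ i.
  rewrite -exprM /e -mulnA -expnSr prednK ?totient_gt0 // exprM -(expr_mod _ (zr_r i)).
  by rewrite Euler_exp_totient ?coprimeXr 1?coprime_sym // expr_mod.
have Tn : congr_mod A n (gauss_sum zq (fun x => chi x ^+ n))
                       (eta ^+ n * gauss_sum zq (fun x => chi x ^+ 1) ^+ n).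
  have := aut_gauss_sum hchi hzr hsigma hsigma_r hsigma_q 1; rewrite muln1 => sT1.
  rewrite eta_n -sT1.
  have AT1 : A (gauss_sum zq (fun x => chi x ^+ 1)) by apply: gauss_sum_int_adjoin hchi hzr _.
  apply: int_adjoin_congr_div Tu sT => //.
  by rewrite eT sT1; apply: gauss_sum_int_adjoin hchi hzr _.
have p_lambda p j : prime p -> (p %| n)%N ->
    (p ^ (l - 1))%N = ((n ^ (l - 1)) ^ lambda p j)%N %[mod l ^ j.+1].
  move=> p_pr pn; apply: (ladic_pow_nat_eqmod hl); last by rewrite !natrX h1.
  by rewrite subn1 -totient_prime // Euler_exp_totient // coprime_sym.
have chi_p p : prime p -> (p %| n)%N -> char_nat chi p = root_pow eta (lambda p).
  move=> p_pr pn; have [x Dx ->] := char_nat_unit chi q_gt1 (coprime_dvdr pn qn).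
  have p_neq_l : ~~ (p %| l ^ k)%N.
    by rewrite -prime_coprime // coprimeXr // coprime_sym (coprime_dvdr pn).
  apply: (character_prime_divisor q_gt1 hl hchi hzq p_pr p_neq_l Dx (ZA _ Au)) => //.
  - exact: congr_mod_eqAmod ZA pn Tu.
  - by move=> j; apply: (gauss_sum_iter_twist hchi hzq hzr hsigma hsigma_r hsigma_q j pn Tn).
  - by move=> j; apply: p_lambda.
move=> p p_pr pn; rewrite (char_nat_eq_eta q_gt1 hl hchi qn ln _ eta_r p_lambda chi_p).
  exact: chi_p.
(* n > 1: the prime p divides n, and n is not 0 because q does not divide it. *)
rewrite (leq_trans (prime_gt1 p_pr)) // dvdn_leq // lt0n.
by apply: contraNneq hqn => ->; apply: dvdn0.
Qed.
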